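(* There is a function $h(k)$ with $h(k)\to0$ as $k\to\infty$ such that whenever $\varepsilon<\frac12$ and $\frac{k}{\log k}(1-2\varepsilon)^2>1+h(k)$, partial recovery in the broadcast tree model is possible even with respect to a strong monotone adversary (i.e.\ there is an estimator of the root spin achieving partial recovery in the strong semirandom broadcast tree model, for every strong adversary).
   Context: Broadcast tree model with parameters $k>0$, $\varepsilon\in[0,\frac12)$ and depth $R$: the root gets a uniformly random spin in $\{\pm1\}$; each node independently has $\mathrm{Pois}(k)$ children, each child independently having the same spin as its parent with probability $1-\varepsilon$ and the opposite spin otherwise, until level $R$; the nodes at level $R$ are the leaves. Strong semirandom broadcast tree model: sample such a precursor tree; whenever a child has spin opposite to its parent, an adversary may replace the entire subtree rooted at that child by an arbitrary subtree (topology and spins) of its choice; the resulting tree topology and leaf spins are observed. An estimator $\hat\sigma_\rho$ of the root spin achieves partial recovery if there is $\eta>\frac12$ with $\Pr[\hat\sigma_\rho=\sigma_\rho]\ge\eta$ as $R\to\infty$. *)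

(* Defs.v *)
From HB Require Import structures.
From mathcomp Require Import all_boot all_order all_algebra.
From mathcomp Require Import all_classical all_reals all_analysis.

Set Implicit Arguments.
Unset Strict Implicit.
Unset Printing Implicit Defensive.

Import Order.TTheory GRing.Theory Num.Theory.
Import numFieldNormedType.Exports.

Local Open Scope classical_set_scope.
Local Open Scope ring_scope.

(* Spins are booleans: true is +1 and false is -1.
   [spin_tree n] is the type of rooted trees of depth at most n with a spin at
   every node.  The leaves are the nodes at level n; a childless node at a
   level below n is an internal node, not a leaf. *)
Fixpoint spin_tree (n : nat) : countType :=
  if n is m.+1 then (bool * seq (spin_tree m))%type else bool.

Definition root_spin (n : nat) : spin_tree n -> bool :=
  match n with
  | 0 => fun t => t
  | m.+1 => fun t => t.1
  end.

(* What is observed of a spin tree: the tree, and the spins of the nodes at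
   level n only. *)
Fixpoint leaf_tree (n : nat) : countType :=
  if n is m.+1 then seq (leaf_tree m) else bool.

Fixpoint observe (n : nat) : spin_tree n -> leaf_tree n :=
  match n with
  | 0 => fun t => t
  | m.+1 => fun t => [seq observe c | c <- t.2]
  end.

(* Trees are represented with ordered children, but the order carries no
   meaning: [leaf_tree_iso] identifies two observations that differ only by a
   reordering of the children of some nodes. *)
Fixpoint leaf_tree_iso (n : nat) : leaf_tree n -> leaf_tree n -> Prop :=
  match n with
  | 0 => fun t u => t = u
  | m.+1 => fun t u =>
      exists2 u' : seq (leaf_tree m), perm_eq u' u &
        size t = size u' /\
        (forall i a b, (i < size t)%N -> leaf_tree_iso (nth a t i) (nth b u' i))
  end.

(* An estimator is a function of the observed unordered tree. *)
Definition is_estimator (f : forall n, leaf_tree n -> bool) : Prop :=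
  forall (n : nat) (t u : leaf_tree n), leaf_tree_iso t u -> f n t = f n u.

Definition edge_prob (R : realType) (eps : R) (parent child : bool) : R :=
  if child == parent then 1 - eps else eps.

(* Probability that the broadcast process started from a root of spin
   [root_spin t] yields the tree t. *)
Fixpoint subtree_pmf (R : realType) (k eps : R) (n : nat) : spin_tree n -> R :=
  match n with
  | 0 => fun _ => 1
  | m.+1 => fun t =>
      poisson_pmf k (size t.2) *
      \prod_(c <- t.2) (edge_prob eps t.1 (root_spin c) * subtree_pmf k eps c)
  end.

Definition broadcast_pmf (R : realType) (k eps : R) (n : nat)
    (t : spin_tree n) : R := 2^-1 * subtree_pmf k eps t.

Lemma esumZl (R : realType) (T : choiceType) (S : set T) (c : R) (a : T -> \bar R) :
  0 <= c -> (forall i, (0 <= a i)%E) ->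
  (\esum_(i in S) (c%:E * a i) = c%:E * \esum_(i in S) a i)%E.
Proof.
move=> c0 a0; rewrite /esum -ereal_supZl//; last first.
  apply/set0P; exists (\sum_(i \in set0) a i)%E.
  by exists set0 => //; exact: fsets_set0.
congr ereal_sup; rewrite image_comp.
by apply: eq_imagel => A _ /=; rewrite ge0_mule_fsumr.
Qed.

Lemma esum_prod_size (R : realType) (T : choiceType) (g : T -> R) (z : R) (m : nat) :
  (forall x, 0 <= g x) -> (\esum_(x in [set: T]) (g x)%:E = z%:E)%E ->
  (\esum_(s in [set s : seq T | size s = m]) (\prod_(c <- s) g c)%:E = (z ^+ m)%:E)%E.
Proof.
move=> g0 gz; have p0 (s : seq T) : 0 <= \prod_(c <- s) g c by apply: prodr_ge0.
have z0 : 0 <= z by rewrite -lee_fin -gz; apply: esum_ge0 => x _; rewrite lee_fin.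
elim: m => [|m IH].
  rewrite (_ : [set _ | _] = [set [::]]) ?esum_set1 ?lee_fin// ?big_nil//.
  by apply/seteqP; split => s /=; [move/size0nil|move->].
rewrite (reindex_esum ([set: T] `*`` (fun=> [set s : seq T | size s = m])) _
   (fun p => p.1 :: p.2)); last first.
  split.
  - by move=> [x s] /= [_ <-].
  - by move=> [x s] [y t] _ _ /= [-> ->].
  - by move=> [|x s]//= [sm]; exists (x, s).
under eq_esum do rewrite big_cons EFinM.
rewrite -(@esum_esum _ _ _ [set: T] (fun=> [set s : seq T | size s = m])
  (fun x s => ((g x)%:E * (\prod_(c <- s) g c)%:E)%E)); last first.
  by move=> x s _ _; rewrite -EFinM lee_fin mulr_ge0.
under eq_esum.
  move=> x _; rewrite esumZl//.
  rewrite IH muleC; over.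
by rewrite esumZl ?exprn_ge0// gz -EFinM -exprSr.
Qed.

Lemma poisson_mass (R : realType) (k : R) : 0 < k ->
  (\esum_(m in [set: nat]) (poisson_pmf k m)%:E = 1)%E.
Proof.
move=> k0; have := @probability_setT _ _ R (poisson_prob k 0%N).
by rewrite /= /poisson_prob k0.
Qed.

Lemma esum_bool (R : realType) (T : choiceType) (F : T -> \bar R) (r : T -> bool) :
  (forall x, (0 <= F x)%E) ->
  (\esum_(x in [set: T]) F x = \esum_(x in [set x | r x = true]) F x
     + \esum_(x in [set x | r x = false]) F x)%E.
Proof.
move=> F0; rewrite (esumID [set x | r x = true])// setTI.
suff -> : setT `&` ~` [set x | r x = true] = [set x | r x = false] by [].
by apply/seteqP; split => x /=; case: (r x) => // -[].
Qed.

Lemma edge_prob_ge0 (R : realType) (eps : R) (s t : bool) :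
  0 <= eps -> eps <= 1 -> 0 <= edge_prob eps s t.
Proof. by move=> e0 e1; rewrite /edge_prob; case: ifP; rewrite ?subr_ge0. Qed.

Lemma subtree_pmf_ge0 (R : realType) (k eps : R) (n : nat) (t : spin_tree n) :
  0 <= eps -> eps <= 1 -> 0 <= subtree_pmf k eps t.
Proof.
move=> e0 e1; elim: n t => [//|n IH] [s cs] /=; rewrite mulr_ge0 ?poisson_pmf_ge0//.
by apply: prodr_ge0 => c _; rewrite mulr_ge0 ?edge_prob_ge0.
Qed.

Lemma subtree_pmf_mass (R : realType) (k eps : R) (n : nat) (s : bool) :
  0 < k -> 0 <= eps -> eps <= 1 ->
  (\esum_(t in [set t : spin_tree n | root_spin t = s])
     (subtree_pmf k eps t)%:E = 1)%E.
Proof.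
move=> k0 e0 e1; elim: n s => [|n IH] s /=; first by rewrite esum_set1 ?lee_fin.
pose g (c : spin_tree n) := edge_prob eps s (root_spin c) * subtree_pmf k eps c.
have g0 c : 0 <= g c by rewrite mulr_ge0 ?edge_prob_ge0 ?subtree_pmf_ge0.
have gm : (\esum_(c in [set: spin_tree n]) (g c)%:E = 1%:E)%E.
  rewrite (esum_bool (@root_spin n)); last by move=> c; rewrite lee_fin.
  have E b : (\esum_(c in [set c : spin_tree n | root_spin c = b]) (g c)%:E =
              (edge_prob eps s b)%:E)%E.
    under eq_esum do rewrite /g EFinM.
    transitivity (\esum_(c in [set c : spin_tree n | root_spin c = b])
                    ((edge_prob eps s b)%:E * (subtree_pmf k eps c)%:E))%E.
      by apply: eq_esum => c /= ->.
    rewrite esumZl ?edge_prob_ge0 ?IH ?mule1// => c.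
    by rewrite lee_fin subtree_pmf_ge0.
  by rewrite !E -EFinD /edge_prob; case: s {g g0 E} => /=; rewrite ?subrK// addrC subrK.
rewrite (reindex_esum [set: seq (spin_tree n)] _ (fun cs => (s, cs))); last first.
  split => //; first by move=> cs ds _ _ [].
  by move=> [b cs] /= ->; exists cs.
rewrite (_ : [set: seq _] = \bigcup_(m in [set: nat])
    [set cs : seq (spin_tree n) | size cs = m]); last first.
  by apply/seteqP; split => cs //= _; exists (size cs).
have p0 cs : 0 <= poisson_pmf k (size cs) * \prod_(c <- cs) g c.
  by rewrite mulr_ge0 ?poisson_pmf_ge0// prodr_ge0.
rewrite esum_bigcupT; last 2 first.
- apply/trivIsetP => i j _ _ /eqP ij; apply/seteqP; split => cs //=.
  by move=> [ci cj]; apply: ij; rewrite -ci -cj.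
- by move=> cs; rewrite lee_fin; exact: p0.
rewrite -[RHS](poisson_mass k0); apply: eq_esum => m _.
transitivity (\esum_(cs in [set cs : seq (spin_tree n) | size cs = m])
                ((poisson_pmf k m)%:E * (\prod_(c <- cs) g c)%:E))%E.
  by apply: eq_esum => cs /= <-; rewrite -EFinM.
rewrite esumZl ?poisson_pmf_ge0//; last by move=> cs; rewrite lee_fin prodr_ge0.
by rewrite (esum_prod_size m g0 gm) expr1n mule1.
Qed.

Lemma broadcast_pmf_mass (R : realType) (k eps : R) (n : nat) :
  0 < k -> 0 <= eps -> eps <= 1 ->
  (\esum_(t in [set: spin_tree n]) (broadcast_pmf k eps t)%:E = 1)%E.
Proof.
move=> k0 e0 e1; under eq_esum do rewrite EFinM.
rewrite esumZl ?invr_ge0//; last by move=> t; rewrite lee_fin subtree_pmf_ge0.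
rewrite (esum_bool (@root_spin n)); last by move=> t; rewrite lee_fin subtree_pmf_ge0.
by rewrite !subtree_pmf_mass// -EFinD -EFinM mulVf// pnatr_eq0.
Qed.

(* [strong_move t u]: a strong adversary can turn the precursor t into u.  The
   subtree of a child whose spin is opposite to its parent's becomes an
   arbitrary tree; a child agreeing with its parent keeps its spin, and the
   adversary can only act further down. *)
Fixpoint strong_move (n : nat) : spin_tree n -> spin_tree n -> Prop :=
  match n with
  | 0 => fun t u => u = t
  | m.+1 => fun t u =>
      [/\ u.1 = t.1, size u.2 = size t.2 &
        forall i a b, (i < size t.2)%N ->
          root_spin (nth a t.2 i) = t.1 ->
          strong_move (nth a t.2 i) (nth b u.2 i)]
  end.

(* X and Y are the precursor and the modified tree, of depth n, as discrete
   random variables on one probability space, so the adversary may use the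
   whole precursor, spins included, and extra randomness. *)
Definition strong_semirandom (R : realType) (k eps : R) (n : nat)
    (d : measure_display) (Omega : measurableType d) (P : probability Omega R)
    (X Y : Omega -> spin_tree n) : Prop :=
  [/\ forall t, measurable (X @^-1` [set t]),
      forall t, measurable (Y @^-1` [set t]),
      forall t, P (X @^-1` [set t]) = (broadcast_pmf k eps t)%:E &
      forall w, strong_move (X w) (Y w)].

Definition partial_recovery (R : realType) (k eps : R)
    (f : forall n, leaf_tree n -> bool) : Prop :=
  exists2 eta : R, 2^-1 < eta &
    \forall n \near \oo,
      forall (d : measure_display) (Omega : measurableType d)
        (P : probability Omega R) (X Y : Omega -> spin_tree n),
        strong_semirandom k eps P X Y ->
        (eta%:E <= P [set w | f n (observe (Y w)) = root_spin (X w)])%E.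

(* Main.v *)
(** Recursive strict majority recovers the root.  Call a vertex robust if more
    than half of its children agree with it and are robust: no adversary can
    then fool the estimator at that vertex.  If a vertex fails to be robust with
    probability at most [p], then among the [Pois(k)] children of a vertex each
    one is disagreeing or not robust with probability at most [eps + p], and a
    Chernoff bound shows that the parent fails with probability at most
    [exp (- k x^2 / 2)], where [x = 1 - 2 eps - 2 p].  Failure therefore stays
    below any [p] with [exp (- k x^2 / 2) <= p].  With [L = ln k], the choice
    [p = 1 / sqrt (k L)] satisfies this once
    [k (1 - 2 eps)^2 > L (1 + 6 / sqrt L)] and [L >= 4]. *)

Require Import Defs.
From HB Require Import structures.
From mathcomp Require Import all_boot all_order all_algebra.
From mathcomp Require Import all_classical all_reals all_analysis.
From mathcomp Require Import ring lra zify.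

Set Implicit Arguments.
Unset Strict Implicit.
Unset Printing Implicit Defensive.

Import Order.TTheory GRing.Theory Num.Theory.
Import numFieldNormedType.Exports.

Local Open Scope classical_set_scope.
Local Open Scope ring_scope.

(** * Recursive majority and robustness against the adversary *)

Fixpoint majority_estimator (n : nat) : leaf_tree n -> bool :=
  match n with
  | 0 => fun t => t
  | m.+1 => fun t => (size t < 2 * count (@majority_estimator m) t)%N
  end.

(** Leaves are robust because their own spins are observed. A childless vertex above the leaf level
    is not: the strict inequality fails at zero. *)
Fixpoint robust (n : nat) : spin_tree n -> bool :=
  match n with
  | 0 => fun _ => true
  | m.+1 => fun t =>
      (size t.2 < 2 * count (fun c => (root_spin c == t.1) && robust c) t.2)%N
  end.

(** Both [leaf_tree_iso] and [strong_move] relate children position by position; this turns such a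
    relation into a comparison of counts. *)
Lemma count_le_nth (S T : Type) (a : pred S) (b : pred T) (s : seq S)
    (t : seq T) (x : S) (y : T) :
  size s = size t ->
  (forall i, (i < size s)%N -> a (nth x s i) -> b (nth y t i)) ->
  (count a s <= count b t)%N.
Proof.
elim: s t => [|u s IH] [|v t]//= [st] ab; apply: leq_add.
  by have := ab 0%N isT; rewrite /=; case: (a u) => // ->.
by apply: IH => // i; exact: (ab i.+1).
Qed.

Lemma majority_is_estimator : is_estimator (@majority_estimator).
Proof.
elim=> [|n IH] t u /=; first by move->.
case=> u' pu [st iso]; rewrite -(permP pu) -(perm_size pu) -st.
(* The heads of nonempty lists supply the default values that [iso] asks for. *)
case: t u' {pu} st iso => [|a t] [|b u']// st iso.
congr (_ < 2 * _)%N; apply/eqP; rewrite eqn_leq; apply/andP; split.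
  by apply: (@count_le_nth _ _ _ _ _ _ a b) => // i it; rewrite (IH _ _ (iso i a b it)).
apply: (@count_le_nth _ _ _ _ _ _ b a) => // i it.
by rewrite (IH _ _ (iso i a b _)) // st.
Qed.

(** An agreeing robust child can only be altered further down, so by induction its estimate is still
    the spin of its parent. These children alone are a strict majority, whatever the replaced
    subtrees show. *)
Lemma robust_majority (n : nat) (t u : spin_tree n) :
  robust t -> strong_move t u -> majority_estimator (observe u) = root_spin t.
Proof.
elim: n t u => [|n IH] t u /=; first by move=> _ ->.
case: t u => [s ts] [s' us] /= maj [_ sz mv].
rewrite size_map count_map.
have cnt : (count (fun c => (root_spin c == s) && robust c) ts <=
            count (fun c => majority_estimator (observe c) == s) us)%N.
  case: ts us sz mv {maj} => [|a ts] [|b us]// sz mv.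
  apply: (@count_le_nth _ _ _ _ _ _ a b) => // i it /andP[/eqP rs rb].
  by rewrite -rs; apply/eqP; apply: (IH _ _ rb); apply: mv.
have {maj cnt} := leq_trans maj (leq_mul (leqnn 2) cnt).
rewrite -sz; case: s {mv}.
  rewrite (@eq_count _ _ (@majority_estimator n \o @observe n)); first by move=> ->.
  by move=> c /=; rewrite eqb_id.
(* The estimator answers [false] on ties, but here the [false] estimates are a strict majority,
   which excludes one of [true]. *)
rewrite (@eq_count _ _ (predC (@majority_estimator n \o @observe n))); last first.
  by move=> c /=; rewrite eqbF_neg.
rewrite -(count_predC (@majority_estimator n \o @observe n) us).
move: (count _ _) (count _ _) => a b maj; apply/negbTE; lia.
Qed.

(** * Mass of the precursor trees that are not robust *)

Section NonRobustMass.
Variables (R : realType) (k eps : R).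
Hypotheses (k0 : 0 < k) (e0 : 0 <= eps) (e1 : eps <= 1).

Let child_pmf (s : bool) (n : nat) (c : spin_tree n) : R :=
  edge_prob eps s (root_spin c) * subtree_pmf k eps c.

Let child_pmf_ge0 s n (c : spin_tree n) : 0 <= child_pmf s c.
Proof. by rewrite mulr_ge0 ?edge_prob_ge0 ?subtree_pmf_ge0. Qed.

Lemma esum_child_pmf (s b : bool) (n : nat) (D : set (spin_tree n)) :
  D `<=` [set c | root_spin c = b] ->
  (\esum_(c in D) (child_pmf s c)%:E =
   (edge_prob eps s b)%:E * \esum_(c in D) (subtree_pmf k eps c)%:E)%E.
Proof.
move=> Db; rewrite -esumZl ?edge_prob_ge0//; last first.
  by move=> c; rewrite lee_fin subtree_pmf_ge0.
by apply: eq_esum => c /Db /= rc; rewrite -EFinM /child_pmf rc.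
Qed.

Lemma child_pmf_mass (s : bool) (n : nat) :
  (\esum_(c in [set: spin_tree n]) (child_pmf s c)%:E = 1)%E.
Proof.
rewrite (esum_bool (@root_spin n)); last by move=> c; rewrite lee_fin.
rewrite (@esum_child_pmf s true n)// (@esum_child_pmf s false n)//.
rewrite !subtree_pmf_mass// !mule1 -EFinD /edge_prob.
by case: s => /=; congr EFin; ring.
Qed.

(** Each summand is [expR (k * (z - 1))] times the Poisson mass of parameter [k * z]. *)
Lemma poisson_pgf (z : R) : 0 < z ->
  (\esum_(m in [set: nat]) (poisson_pmf k m * z ^+ m)%:E =
   (expR (k * (z - 1)))%:E)%E.
Proof.
move=> z0; have kz : 0 < k * z by rewrite mulr_gt0.
rewrite -[RHS]mule1 -(poisson_mass kz) -esumZl ?expR_ge0//; last first.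
  by move=> m; rewrite lee_fin poisson_pmf_ge0.
apply: eq_esum => m _; rewrite -EFinM /poisson_pmf k0 kz; congr EFin.
rewrite exprMn [X in _ = expR X * _](_ : _ = k * z - k); last by ring.
rewrite expRD !expRN; field.
by rewrite pnatr_eq0 -lt0n fact_gt0 !gt_eqF ?expR_gt0.
Qed.

(* Chernoff bound: a vertex that is not robust has at least as many children
   that disagree or are not robust as other ones, so a product of weights
   [1 + x] and [1 / (1 + x)] over its children is at least [1].  The choice
   [1 + x] makes the generating function equal to [expR (- k x^2 / 2)]. *)
Lemma nonrobust_mass_step (n : nat) (s : bool) (p x : R) :
  0 <= x -> x <= 1 -> eps + p <= (1 - x) / 2 ->
  (\esum_(c in [set c : spin_tree n | root_spin c = s /\ ~~ robust c])
     (subtree_pmf k eps c)%:E <= p%:E)%E ->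
  (\esum_(t in [set t : spin_tree n.+1 | root_spin t = s /\ ~~ robust t])
     (subtree_pmf k eps t)%:E <= (expR (- (k * x ^+ 2 / 2)))%:E)%E.
Proof.
move=> x0 x1 epx IH.
pose A (c : spin_tree n) := (root_spin c == s) && robust c.
pose l := 1 + x.
have l1 : 1 <= l by rewrite /l; lra.
have l0 : 0 < l by lra.
pose w c := if A c then l^-1 else l.
have w0 c : 0 <= w c by rewrite /w; case: ifP; rewrite ?invr_ge0 ltW.
pose g c := child_pmf s c * w c.
have g0 c : 0 <= g c by rewrite mulr_ge0.
have p0 : 0 <= p.
  rewrite -lee_fin; apply: le_trans IH; apply: esum_ge0 => c _.
  by rewrite lee_fin subtree_pmf_ge0.
have cE c : (0 <= (child_pmf s c)%:E)%E by rewrite lee_fin.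
have [b [b0 bu bE]] : exists b : R, [/\ 0 <= b, b <= (1 - x) / 2 &
    (\esum_(c in ~` [set c | A c]) (child_pmf s c)%:E = b%:E)%E].
  have ub : (\esum_(c in ~` [set c | A c]) (child_pmf s c)%:E <= ((1 - x) / 2)%:E)%E.
    (* A child outside [A] either agrees without being robust, with mass at most
       [(1 - eps) * p <= p], or disagrees, with mass [eps]. *)
    rewrite (esumID [set c | root_spin c = s])//.
    apply: (@le_trans _ _ (p%:E + eps%:E)%E); last by rewrite -EFinD lee_fin addrC.
    apply: leeD.
      rewrite (@esum_child_pmf s s n); last by move=> c [].
      rewrite {1}/edge_prob eqxx.
      rewrite (_ : _ `&` _ = [set c | root_spin c = s /\ ~~ robust c]); last first.
        apply/seteqP; split => c /=; rewrite /A.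
          by case=> /negP + rs; rewrite rs eqxx.
        by case=> rs nr; rewrite rs eqxx; split => //; apply/negP.
      apply: (@le_trans _ _ (1 * p%:E)%E); last by rewrite mul1e.
      apply: lee_pmul => //.
      - by rewrite lee_fin; lra.
      - by apply: esum_ge0 => c _; rewrite lee_fin subtree_pmf_ge0.
      - by rewrite lee_fin gerBl.
    rewrite (_ : _ `&` _ = [set c | root_spin c = ~~ s]); last first.
      apply/seteqP; split => c /=; rewrite /A.
        by case=> _; case: (s) (root_spin c) => [] [].
      by move=> ->; case: (s).
    rewrite (@esum_child_pmf s (~~ s) n)// subtree_pmf_mass// mule1 /edge_prob.
    by case: (s).
  exists (fine (\esum_(c in ~` [set c | A c]) (child_pmf s c)%:E)).
  have lb : (0 <= \esum_(c in ~` [set c | A c]) (child_pmf s c)%:E)%E.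
    exact: esum_ge0.
  have fin : \esum_(c in ~` [set c | A c]) (child_pmf s c)%:E \is a fin_num.
    by rewrite ge0_fin_numE// (le_lt_trans ub)// ltry.
  by split; [exact: fine_ge0|rewrite -lee_fin fineK|rewrite fineK].
have aE : (\esum_(c in [set c | A c]) (child_pmf s c)%:E = (1 - b)%:E)%E.
  have := child_pmf_mass s n; rewrite (esumID [set c | A c])// !setTI bE => mass.
  by rewrite -[RHS]/(1 - b%:E)%E -mass addeK.
pose z := l^-1 * (1 - b) + l * b.
have gz : (\esum_(c in [set: spin_tree n]) (g c)%:E = z%:E)%E.
  rewrite (esumID [set c | A c]); last by move=> c _; rewrite lee_fin.
  rewrite !setTI /z EFinD !EFinM -aE -bE -!esumZl ?invr_ge0 ?(ltW l0)//.
  by congr (_ + _)%E; apply: eq_esum => c /=; rewrite /g /w -EFinM;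
    [move=> ->|move=> /negP/negbTE ->]; rewrite mulrC.
(* Since [l^-1 <= 1 <= l], [z] is nondecreasing in [b]. At [b = (1 - x) / 2] its two terms are
   [1 / 2] and [(1 - x ^+ 2) / 2]. *)
have zu : z <= 1 - x ^+ 2 / 2.
  have -> : 1 - x ^+ 2 / 2 = l^-1 * (1 - (1 - x) / 2) + l * ((1 - x) / 2).
    by rewrite /l; field; rewrite -/l gt_eqF.
  have li1 : l^-1 <= 1 by rewrite invf_le1.
  by rewrite /z; nra.
have z0 : 0 <= z.
  by rewrite -lee_fin -gz; apply: esum_ge0 => c _; rewrite lee_fin.
apply: (@le_trans _ _ (\esum_(cs in [set: seq (spin_tree n)])
   (poisson_pmf k (size cs) * \prod_(c <- cs) g c)%:E)%E).
  rewrite (reindex_esum [set cs : seq (spin_tree n) | ~~ (size cs < 2 * count A cs)%N] _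
    (fun cs => (s, cs))); last first.
    split => //=; first by move=> cs ds _ _ [].
    by move=> [b' cs] /= [-> nr]; exists cs.
  rewrite esum_mkcond; apply: le_esum => cs _; case: ifP => [|_]; last first.
    by rewrite lee_fin mulr_ge0 ?poisson_pmf_ge0 ?prodr_ge0.
  rewrite inE /= -leqNgt => szA; rewrite lee_fin ler_wpM2l ?poisson_pmf_ge0//.
  rewrite -[leLHS]/(\prod_(c <- cs) child_pmf s c) [leRHS]big_split /=.
  rewrite -[leLHS]mulr1 ler_wpM2l ?prodr_ge0//.
  (* By [szA], at most half of the children lie in [A], so the power of [l] in the numerator
     dominates and the product is at least 1. *)
  have -> : \prod_(c <- cs) w c = l ^+ (size cs - count A cs) / l ^+ count A cs.
    elim: cs {szA} => [|c cs IHc]; first by rewrite big_nil expr0 divr1.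
    rewrite big_cons IHc /w /=; have := count_size A cs; case: (A c) => cA.
      by rewrite subSS add1n exprS; field; rewrite expf_neq0 gt_eqF.
    by rewrite add0n subSn// exprS mulrA.
  rewrite ler_pdivlMr ?exprn_gt0// mul1r ler_weXn2l//.
  by rewrite leq_subRL ?count_size// addnn -mul2n.
rewrite (_ : [set: seq _] = \bigcup_(m in [set: nat])
    [set cs : seq (spin_tree n) | size cs = m]); last first.
  by apply/seteqP; split => cs //= _; exists (size cs).
have P0 cs : 0 <= poisson_pmf k (size cs) * \prod_(c <- cs) g c.
  by rewrite mulr_ge0 ?poisson_pmf_ge0// prodr_ge0.
rewrite esum_bigcupT; last 2 first.
- apply/trivIsetP => i j _ _ /eqP ij; apply/seteqP; split => cs //=.
  by move=> [ci cj]; apply: ij; rewrite -ci -cj.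
- by move=> cs; rewrite lee_fin; exact: P0.
have -> : - (k * x ^+ 2 / 2) = k * ((1 - x ^+ 2 / 2) - 1) by ring.
(* The generating function is taken at the bound on [z], which is positive as [x <= 1]; the
   comparison with [z] is then made for each number [m] of children. *)
rewrite -poisson_pgf; last by nra.
apply: le_esum => m _.
rewrite (_ : (\esum_(cs in _) _)%E = ((poisson_pmf k m)%:E *
    \esum_(cs in [set cs : seq (spin_tree n) | size cs = m]) (\prod_(c <- cs) g c)%:E)%E).
  rewrite (esum_prod_size m g0 gz) -EFinM lee_fin ler_wpM2l ?poisson_pmf_ge0//.
  by rewrite lerXn2r// nnegrE//; nra.
rewrite -esumZl ?poisson_pmf_ge0//; last by move=> cs; rewrite lee_fin prodr_ge0.
by apply: eq_esum => cs /= <-; rewrite -EFinM.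
Qed.

Lemma nonrobust_mass (p : R) (n : nat) (s : bool) :
  0 <= p -> 2 * p <= 1 - 2 * eps ->
  expR (- (k * (1 - 2 * eps - 2 * p) ^+ 2 / 2)) <= p ->
  (\esum_(t in [set t : spin_tree n | root_spin t = s /\ ~~ robust t])
     (subtree_pmf k eps t)%:E <= p%:E)%E.
Proof.
move=> p0 pe fix_p; elim: n => [|n IH].
  rewrite (_ : [set _ | _] = set0) ?esum_set0 ?lee_fin//.
  by apply/seteqP; split => t //= [].
apply: (@le_trans _ _ (expR (- (k * (1 - 2 * eps - 2 * p) ^+ 2 / 2)))%:E);
  last by rewrite lee_fin.
(* With [x = 1 - 2 * eps - 2 * p], [eps + p] equals [(1 - x) / 2] exactly. *)
by apply: (@nonrobust_mass_step n s p) => //; move: e0; lra.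
Qed.

Lemma nonrobust_broadcast_mass (p : R) (n : nat) :
  0 <= p -> 2 * p <= 1 - 2 * eps ->
  expR (- (k * (1 - 2 * eps - 2 * p) ^+ 2 / 2)) <= p ->
  (\esum_(t in [set t : spin_tree n | ~~ robust t])
     (broadcast_pmf k eps t)%:E <= p%:E)%E.
Proof.
move=> p0 pe fix_p; have t0 n' (t : spin_tree n') : (0 <= (subtree_pmf k eps t)%:E)%E.
  by rewrite lee_fin subtree_pmf_ge0.
under eq_esum do rewrite EFinM.
rewrite esumZl ?invr_ge0// (esumID [set t | root_spin t = true])//.
rewrite (_ : _ `&` [set _ | _] = [set t | root_spin t = true /\ ~~ robust t]);
  last by apply/seteqP; split => t /= [].
rewrite (_ : _ `&` ~` _ = [set t | root_spin t = false /\ ~~ robust t]); last first.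
  by apply/seteqP; split => t /= []; case: (root_spin t).
apply: (@le_trans _ _ (2^-1%:E * (p%:E + p%:E))%E).
  by apply: lee_wpmul2l; rewrite ?lee_fin ?invr_ge0//; apply: leeD; exact: nonrobust_mass.
by rewrite -EFinD -EFinM lee_fin; lra.
Qed.

End NonRobustMass.

(** * From masses of trees to probabilities of events *)

Lemma countable_preimage_measurable (d : measure_display)
    (Omega : measurableType d) (T : countType) (X : Omega -> T) (D : set T) :
  (forall t, measurable (X @^-1` [set t])) -> measurable (X @^-1` D).
Proof.
move=> mX; rewrite (_ : _ @^-1` D = \bigcup_t (X @^-1` [set t] `&` [set w | D t])).
  apply: countable_bigcupT_measurable; first exact: countableP.
  move=> t; apply: measurableI => //; case: (pselect (D t)) => Dt.
    by have -> : [set _ : Omega | D t] = setT by apply/seteqP; split.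
  by have -> : [set _ : Omega | D t] = set0 by apply/seteqP; split.
by apply/seteqP; split => w /=; [move=> Dw; exists (X w)|case=> t _ [<-]].
Qed.

Lemma probability_preimage_le_esum (R : realType) (d : measure_display)
    (Omega : measurableType d) (P : probability Omega R) (T : countType)
    (X : Omega -> T) (D : set T) (q : T -> R) :
  (forall t, measurable (X @^-1` [set t])) ->
  (forall t, P (X @^-1` [set t]) = (q t)%:E) ->
  (P (X @^-1` D) <= \esum_(t in D) (q t)%:E)%E.
Proof.
(* [F i] holds the point of [D] with code [i], if any, so countable subadditivity applies along the
   codes. *)
move=> mX PX; pose F i := [set t | D t /\ pickle t = i].
have q0 t : (0 <= (q t)%:E)%E by rewrite -PX.
have DF : D = \bigcup_i F i.
  by apply/seteqP; split => t; [move=> Dt; exists (pickle t)|case=> i _ []].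
rewrite [in leRHS]DF nneseries_sum_bigcup//; last first.
  apply/trivIsetP => i j _ _ /eqP ij; apply/seteqP; split => t //=.
  by case=> -[_ ti] [_ tj]; apply: ij; rewrite -ti.
apply: (@le_trans _ _ (\sum_(0 <= i <oo) P (X @^-1` F i))%E).
  apply: measure_sigma_subadditive.
  - by move=> i; exact: countable_preimage_measurable.
  - exact: countable_preimage_measurable.
  - by rewrite {1}DF preimage_bigcup.
apply: lee_nneseries => i _; first by move=> _; exact: measure_ge0.
have [[t [Dt ti]]|nF] := pselect (exists t, F i t).
  rewrite (_ : F i = [set t]) ?esum_set1 ?PX//.
  apply/seteqP; split => u /= => [[_ ui]|->//].
  by apply: (pcan_inj (@pickleK T)); rewrite ui ti.
rewrite (_ : F i = set0) ?preimage_set0 ?measure0 ?esum_set0//.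
by apply/seteqP; split => t // Ft; apply: nF; exists t.
Qed.

(** Failure forces a non-robust precursor, an event about [X] alone, so the same bound serves every
    adversary and every depth. *)
Lemma majority_partial_recovery (R : realType) (k eps p : R) :
  0 < k -> 0 <= eps -> 0 <= p -> p < 2^-1 -> 2 * p <= 1 - 2 * eps ->
  expR (- (k * (1 - 2 * eps - 2 * p) ^+ 2 / 2)) <= p ->
  partial_recovery k eps (@majority_estimator).
Proof.
move=> k0 e0 p0 p2 pe fix_p; exists (1 - p); first by lra.
apply: nearW => n d Omega P X Y [mX mY PX mv].
pose S := [set w | majority_estimator (observe (Y w)) = root_spin (X w)].
have mS : measurable S.
  rewrite (_ : S = \bigcup_t (X @^-1` [set t] `&`
      Y @^-1` [set u | majority_estimator (observe u) = root_spin t])); last first.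
    by apply/seteqP; split => w; [exists (X w)|case=> t _ [/= <-]].
  apply: countable_bigcupT_measurable; first exact: countableP.
  by move=> t; apply: measurableI => //; exact: countable_preimage_measurable.
have nS : ~` S `<=` X @^-1` [set t | ~~ robust t].
  by move=> w /= nSw; apply/negP => rw; apply: nSw; exact: robust_majority.
have : (P (~` S) <= p%:E)%E.
  have e1 : eps <= 1 by lra.
  have bad := @nonrobust_broadcast_mass _ _ _ k0 e0 e1 p n p0 pe fix_p.
  have le_bad := probability_preimage_le_esum [set t | ~~ robust t] mX PX.
  apply: (le_trans _ (le_trans le_bad bad)).
  apply: le_measure => //; rewrite inE; first exact: measurableC.
  exact: countable_preimage_measurable.
rewrite probability_setC// => le_p.
move: le_p; rewrite -/S; case: (P S) => [r| |]//; last by rewrite leey.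
by rewrite -EFinB !lee_fin; lra.
Qed.

(** * Choice of [p] and of [h] *)

Lemma threshold_fixpoint (R : realType) (k t : R) :
  expR 4 <= k -> 0 <= t -> 1 + 6 / Num.sqrt (ln k) < k / ln k * t ^+ 2 ->
  exists p : R, [/\ 0 <= p, p < 2^-1, 2 * p <= t &
    expR (- (k * (t - 2 * p) ^+ 2 / 2)) <= p].
Proof.
move=> k4 t0; have k0 : 0 < k by apply: lt_le_trans k4; rewrite expR_gt0.
set L := ln k; have L4 : 4 <= L by rewrite /L -(@expRK R 4) ler_ln ?posrE ?expR_gt0.
have kE : expR L = k by rewrite lnK.
have L0 : 0 < L by lra.
set r := Num.sqrt L; have r2 : r ^+ 2 = L by rewrite sqr_sqrtr// ltW.
have r0 : 0 <= r by exact: sqrtr_ge0.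
have rge2 : 2 <= r by nra.
have lnL : ln L <= 2 * r - 2.
  rewrite -r2 lnXn; last by lra.
  have lnr : ln (1 + (r - 1)) <= r - 1 by apply: le_ln1Dx; lra.
  by move: lnr; rewrite [1 + _]addrC subrK mulr2n; lra.
move=> hyp.
have kt : L + 6 * r <= k * t ^+ 2.
  have -> : k * t ^+ 2 = L * (k / L * t ^+ 2) by field; rewrite gt_eqF.
  have -> : L + 6 * r = L * (1 + 6 / r).
    by rewrite -r2; field; rewrite gt_eqF//; lra.
  by rewrite ler_pM2l// ltW.
(* This is 1 / sqrt(k L), written so that comparing exponentials with [p] means comparing
   exponents. *)
pose p := expR (- ((L + ln L) / 2)).
have p0 : 0 < p by exact: expR_gt0.
have p2 : k * L * p ^+ 2 = 1.
  rewrite /p -expRM_natl.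
  have -> : 2%:R * - ((L + ln L) / 2) = - L + - ln L by field.
  by rewrite expRD !expRN kE lnK//; field; rewrite !gt_eqF.
have kgt : 4 <= k.
  by rewrite -kE; apply: le_trans (expR_ge1Dx L); lra.
exists p; split; first exact: ltW.
- have : 16 * p ^+ 2 <= 1 by rewrite -p2; apply: ler_wpM2r; [exact: sqr_ge0|nra].
  by nra.
- have : (2 * p) ^+ 2 <= t ^+ 2.
    rewrite -(ler_pM2l k0); apply: le_trans kt.
    have : L * (k * p ^+ 2) = 1 by rewrite -p2; ring.
    have : 0 <= k * p ^+ 2 by rewrite mulr_ge0 ?sqr_ge0// ltW.
    by rewrite exprMn; move: (k * p ^+ 2) (L) L4 r0 => a b; nra.
  by rewrite ler_sqr ?nnegrE//; lra.
(* It remains to show [L + ln L <= k * (t - 2 * p) ^+ 2]. In the expanded square, [amgm] costs a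
   share [1 / L] of [k * t ^+ 2] and a constant 4; by [num] at least [L + 2 * r - 2] is left, and
   [lnL] concludes. *)
- rewrite {2}/p ler_expR lerN2 ler_pM2r ?invr_gt0//.
  have amgm : 4 * k * t * p <= k * t ^+ 2 / L + 4.
    rewrite -(ler_pM2l L0) -subr_ge0.
    have -> : L * (k * t ^+ 2 / L + 4) - L * (4 * k * t * p)
        = k * (t - 2 * L * p) ^+ 2 + 4 * L * (1 - k * L * p ^+ 2).
      by field; rewrite gt_eqF.
    by rewrite p2 subrr mulr0 addr0 mulr_ge0 ?sqr_ge0// ltW.
  have kp : 0 <= k * p ^+ 2 by rewrite mulr_ge0 ?sqr_ge0// ltW.
  have main : (L + 6 * r) * (1 - L^-1) <= k * t ^+ 2 * (1 - L^-1).
    by rewrite ler_wpM2r// subr_ge0 invf_le1//; lra.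
  (* As [r >= 2], the loss [1 + 6 / r] is at most 4, and [4 * r] covers the remaining 6. *)
  have num : L + 2 * r + 2 <= (L + 6 * r) * (1 - L^-1).
    have -> : (L + 6 * r) * (1 - L^-1) = L + 6 * r - 1 - 6 * r^-1.
      by rewrite -r2; field; rewrite gt_eqF//; lra.
    have : r^-1 <= 2^-1 by rewrite lef_pV2 ?posrE//; lra.
    lra.
  have -> : k * (t - 2 * p) ^+ 2 =
    k * t ^+ 2 * (1 - L^-1) + k * t ^+ 2 / L - 4 * k * t * p + 4 * (k * p ^+ 2) by ring.
  lra.
Qed.

Lemma cvg_inv_sqrt_ln (R : realType) :
  6 / Num.sqrt (ln x) @[x --> +oo] --> (0 : R).
Proof.
apply/cvgr0Pnorm_le => e e0.
near=> x.
(* The threshold is the solution of 6 / sqrt(ln x) = e. *)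
have xb : expR ((6 / e) ^+ 2) <= x by near: x; exact: nbhs_pinfty_ge.
have b0 : 0 < 6 / e by rewrite divr_gt0.
have x0 : 0 < x by apply: lt_le_trans xb; rewrite expR_gt0.
have le_s : 6 / e <= Num.sqrt (ln x).
  rewrite -(ger0_norm (ltW b0)) -sqrtr_sqr ler_wsqrtr//.
  by rewrite -(@expRK R (_ ^+ 2)) ler_ln ?posrE ?expR_gt0.
have s0 : 0 < Num.sqrt (ln x) by exact: lt_le_trans le_s.
rewrite ger0_norm; last by rewrite divr_ge0// ltW.
by rewrite ler_pdivrMr// -ler_pdivrMl// mulrC.
Unshelve. all: by end_near. Qed.

Theorem theorem4 (R : realType) :
  exists2 h : R -> R, h x @[x --> +oo] --> (0 : R) &
    forall k eps : R, 0 < k -> 0 <= eps -> eps < 2^-1 ->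
      1 + h k < k / ln k * (1 - 2 * eps) ^+ 2 ->
      exists2 f : forall n : nat, leaf_tree n -> bool,
        is_estimator f & partial_recovery k eps f.
Proof.
(* Below [expR 4] this [h] makes the hypothesis on [k] and [eps] contradictory. *)
exists (fun k => if expR 4 <= k then 6 / Num.sqrt (ln k) else `|k / ln k|).
  apply: cvg_trans (@cvg_inv_sqrt_ln R); apply: near_eq_cvg; near=> x.
  by rewrite ifT//; near: x; exact: nbhs_pinfty_ge.
move=> k eps k0 e0 e2; case: ifP => [k4|_] hyp.
  have t0 : 0 <= 1 - 2 * eps by lra.
  have [p [p0 p2 pt fix_p]] := threshold_fixpoint k4 t0 hyp.
  exists (@majority_estimator); first exact: majority_is_estimator.
  exact: majority_partial_recovery fix_p.
(* Since [(1 - 2 * eps) ^+ 2 <= 1], the right-hand side of [hyp] is at most the absolute value of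
   [k / ln k], whatever the sign of [ln k]. *)
exfalso; move: hyp; apply/negP; rewrite -leNgt.
have := ler_norm (k / ln k); have := normr_ge0 (k / ln k).
move: (k / ln k) => a na la.
have : (1 - 2 * eps) ^+ 2 <= 1 by nra.
have := sqr_ge0 (1 - 2 * eps); nra.
Unshelve. all: by end_near. Qed.
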